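(* Let $n\ge 1$ and let $B$ be a real $n\times n$ matrix with $n$ distinct eigenvalues in $\mathbb{C}$. Then $B$ is similar to a real tridiagonal $n\times n$ matrix all of whose superdiagonal and subdiagonal entries are nonzero.
   Context: A tridiagonal matrix $T$ has $T_{i,j}=0$ whenever $|i-j|>1$; its superdiagonal entries are $T_{i,i+1}$ and its subdiagonal entries are $T_{i+1,i}$, for $1\le i\le n-1$. For $n=1$ the condition on these entries is vacuous. *)

(* Defs.v *)
From mathcomp Require Import all_boot all_order all_algebra.
From mathcomp Require Import reals.
From mathcomp Require Import complex.

Set Implicit Arguments.
Unset Strict Implicit.
Unset Printing Implicit Defensive.

Import Order.TTheory GRing.Theory Num.Theory.

Local Open Scope ring_scope.
Local Open Scope complex_scope.

(* mathcomp's [eigenvalue] uses row eigenvectors v *m A = z *: v; this gives the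
   same scalars as column eigenvectors. *)
Definition has_distinct_complex_eigenvalues (R : realType) (n : nat)
    (B : 'M[R]_n) : Prop :=
  exists2 s : n.-tuple R[i], uniq s &
    forall z, z \in s -> eigenvalue (map_mx (real_complex R) B) z.

Definition tridiagonal (R : realType) (n : nat) (T : 'M[R]_n) : Prop :=
  forall i j : 'I_n, (i.+1 < j)%N || (j.+1 < i)%N -> T i j = 0.

(* The pair (i, j) with j = i + 1 carries both the superdiagonal entry T i j
   and the subdiagonal entry T j i. *)
Definition off_diagonals_nonzero (R : realType) (n : nat) (T : 'M[R]_n) : Prop :=
  forall i j : 'I_n, j = i.+1 :> nat -> T i j != 0 /\ T j i != 0.

(* Main.v *)
Require Import Defs.
From mathcomp Require Import all_boot all_order all_algebra.
From mathcomp Require Import reals.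
From mathcomp Require Import complex.
From mathcomp Require Import perm.

Set Implicit Arguments.
Unset Strict Implicit.
Unset Printing Implicit Defensive.

Import GRing.Theory Num.Theory.

Local Open Scope ring_scope.

(** Nonsymmetric Lanczos reduction. Choose a real row [v] and a real column [w],
    and put [K = (v B^i)_i], [W = (B^j w)_j]; then [K W] is the Hankel matrix of
    the moments [v B^(i + j) w]. If all its leading minors are nonzero, then
    [K W = L U], and
      [T = L^-1 (K B K^-1) L = U (W^-1 B W) U^-1]
    is similar to [B]. The matrices [K B K^-1] and [W^-1 B W] are Hessenberg of
    opposite types with ones next to the diagonal, and the triangular factors
    preserve this shape, so [T] is tridiagonal with nonzero off-diagonals. Both
    [v] and [w] exist by genericity along one-parameter polynomial families. *)

(** * Polynomial genericity and determinants along a line of matrices *)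

Lemma poly_neq0_nonroot (F : numDomainType) (p : {poly F}) :
  p != 0 -> exists t, p.[t] != 0.
Proof.
(* In characteristic 0 these are [size p] distinct points, one more than the degree of [p]. *)
move=> p0; pose s := [seq i%:R : F | i <- iota 0 (size p)].
have us : uniq s.
  by rewrite map_inj_uniq ?iota_uniq // => i j /eqP; rewrite eqr_nat => /eqP.
case: (boolP (all (root p) s)) => [ps|/allPn[t _ pt]]; last by exists t.
by have := max_poly_roots p0 ps us; rewrite size_map size_iota ltnn.
Qed.

Definition det_pencil (F : comNzRingType) n (A B : 'M[F]_n) : {poly F} :=
  \det (map_mx polyC A + 'X *: map_mx polyC B).

Lemma horner_det_pencil (F : comNzRingType) n (A B : 'M[F]_n) t :
  (det_pencil A B).[t] = \det (A + t *: B).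
Proof.
rewrite /det_pencil -/(horner_eval t _) -det_map_mx.
congr (\det _); apply/matrixP=> i j.
by rewrite !mxE /= /horner_eval hornerD hornerM hornerX !hornerC.
Qed.

Lemma map_det_pencil (F F' : comNzRingType) (f : {rmorphism F -> F'}) n
    (A B : 'M[F]_n) :
  map_poly f (det_pencil A B) = det_pencil (map_mx f A) (map_mx f B).
Proof.
rewrite /det_pencil -det_map_mx; congr (\det _); apply/matrixP=> i j.
by rewrite !mxE rmorphD rmorphM /= map_polyX !map_polyC.
Qed.

Lemma det_pencil_neq0l (F : comNzRingType) n (A B : 'M[F]_n) :
  \det A != 0 -> det_pencil A B != 0.
Proof.
apply: contra_neq => p0.
by rewrite -[A]addr0 -(scale0r B) -horner_det_pencil p0 horner0.
Qed.

(** The reversed pencil [B + s *: A] is [s] times [A + s^-1 *: B]; the factor ['X] secures a point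
    with [s] nonzero. *)
Lemma det_pencil_neq0r (F : numFieldType) n (A B : 'M[F]_n) :
  \det B != 0 -> det_pencil A B != 0.
Proof.
move=> dB; have /poly_neq0_nonroot[s] : 'X * det_pencil B A != 0.
  by rewrite mulf_neq0 ?polyX_eq0 ?det_pencil_neq0l.
rewrite hornerM hornerX mulf_eq0 negb_or horner_det_pencil => /andP[s0].
have -> : B + s *: A = s *: (A + s^-1 *: B).
  by rewrite scalerDr scalerA mulfV // scale1r addrC.
rewrite detZ mulf_eq0 negb_or => /andP[_]; apply: contra_neq => p0.
by rewrite -horner_det_pencil p0 horner0.
Qed.

(** * Triangular factorization and Hessenberg shapes *)

Section Triangular.
Variable F : fieldType.

Lemma trig_unit_diag n (L : 'M[F]_n) i :
  is_trig_mx L -> L \in unitmx -> L i i != 0.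
Proof.
move=> tL; rewrite unitmxE unitfE (det_trig tL) => /prodf_neq0; exact.
Qed.

(** Strong induction on the row: in entry [(i, j)] of [L *m invmx L = 1] with [i < j], only the term
    [L i i * invmx L i j] survives. *)
Lemma invmx_trig n (L : 'M[F]_n) :
  L \in unitmx -> is_trig_mx L -> is_trig_mx (invmx L).
Proof.
move=> uL tL; apply/is_trig_mxP=> i j.
have [m] := ubnP (i : nat); elim: m i => // m IH i im ij.
have /matrixP/(_ i j) := mulmxV uL.
rewrite !mxE (_ : i == j = false); last by rewrite -val_eqE ltn_eqF.
rewrite (bigD1 i) //= big1 ?addr0 => [/eqP|k ki].
  by rewrite mulf_eq0 (negPf (trig_unit_diag i tL uL)) => /eqP.
case: (ltngtP k i) => [lt|lt|/val_inj/eqP]; last by rewrite (negPf ki).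
  by rewrite (IH k) ?mulr0 //; [exact: leq_trans lt _ | exact: ltn_trans lt ij].
by move/is_trig_mxP: tL => ->; rewrite ?mul0r.
Qed.

(** Bordering: the invertible leading block determines the new row of [L] and column of [U], and the
    new corner of [U] is the Schur complement. *)
Lemma LU_of_leading_minors (h : nat -> nat -> F) n :
  (forall k, (k <= n)%N -> \det (\matrix_(i < k, j < k) h i j) != 0) ->
  exists L U : 'M[F]_n,
    [/\ is_trig_mx L, is_trig_mx U^T & \matrix_(i < n, j < n) h i j = L *m U].
Proof.
elim: n => [|n IH] hn.
  exists 0, 0.
  by split; [apply/is_trig_mxP | apply/is_trig_mxP | apply/matrixP] => -[].
have [L [U [tL tU eLU]]] := IH (fun k kn => hn k (leqW kn)).
have : L *m U \in unitmx by rewrite -eLU unitmxE unitfE hn.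
rewrite unitmx_mul => /andP[uL uU]; rewrite -addn1.
pose b := \col_(i < n) h i n; pose c := \row_(j < n) h n j.
exists (block_mx L 0 (c *m invmx U) 1%:M).
exists (block_mx U (invmx L *m b) 0
  ((h n n)%:M - c *m invmx U *m (invmx L *m b))).
have tb m (A : 'M[F]_m) (d : 'M_(1, m)) (e : 'M_1) :
    is_trig_mx A -> is_trig_mx (block_mx A 0 d e).
  move=> /is_trig_mxP tA; apply/is_trig_mxP=> i j.
  case: (split_ordP i) => i' ->; case: (split_ordP j) => j' -> /=.
  - by rewrite block_mxEul; apply: tA.
  - by rewrite block_mxEur mxE.
  - by rewrite ltnNge (leq_trans (ltnW (ltn_ord j'))) // leq_addr.
  - by rewrite !ord1 ltnn.
split; first exact: tb.
  by rewrite tr_block_mx trmx0 tb.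
rewrite mulmx_block !mul0mx !mulmx0 !mul1mx !addr0 mulmxKV // mulKVmx //.
rewrite addrC subrK -eLU; apply/matrixP=> i j; rewrite mxE.
case: (split_ordP i) => i' ->; case: (split_ordP j) => j' -> /=.
- by rewrite block_mxEul mxE.
- by rewrite block_mxEur mxE ord1 /= addn0.
- by rewrite block_mxEdl mxE ord1 /= addn0.
- by rewrite block_mxEdr mxE !ord1 /= addn0.
Qed.

(** Only entries above the diagonal are constrained, so the target shape amounts to this condition
    on both [T] and [T^T]. *)
Definition unreduced_hessenberg n (C : 'M[F]_n) :=
  (forall i j : 'I_n, (i.+1 < j)%N -> C i j = 0) /\
  (forall i j : 'I_n, j = i.+1 :> nat -> C i j != 0).

(** Strictly above the diagonal, the factor [L] merely rescales row [i] of [C] by [L i i]. *)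
Lemma hessenberg_mull n (L C : 'M[F]_n) :
  is_trig_mx L -> L \in unitmx -> unreduced_hessenberg C ->
  unreduced_hessenberg (L *m C).
Proof.
move=> tL uL [C0 C1].
have E (i j : 'I_n) : (i < j)%N -> (L *m C) i j = L i i * C i j.
  move=> ij; rewrite mxE (bigD1 i) //= big1 ?addr0 // => k ki.
  case: (ltngtP k i) => [lt|lt|/val_inj/eqP]; last by rewrite (negPf ki).
    by rewrite (C0 k) ?mulr0 // (leq_ltn_trans lt).
  by move/is_trig_mxP: tL => ->; rewrite ?mul0r.
split=> i j ij; first by rewrite E ?C0 ?mulr0 // ltnW.
by rewrite E ?ij // mulf_neq0 ?C1 // trig_unit_diag.
Qed.

Lemma hessenberg_mulr n (L C : 'M[F]_n) :
  is_trig_mx L -> L \in unitmx -> unreduced_hessenberg C ->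
  unreduced_hessenberg (C *m L).
Proof.
move=> tL uL [C0 C1].
have E (i j : 'I_n) : (i < j)%N -> (C *m L) i j = C i j * L j j.
  move=> ij; rewrite mxE (bigD1 j) //= big1 ?addr0 // => k kj.
  case: (ltngtP k j) => [lt|lt|/val_inj/eqP]; last by rewrite (negPf kj).
    by move/is_trig_mxP: tL => ->; rewrite ?mulr0.
  by rewrite (C0 i) ?mul0r // (leq_ltn_trans ij).
split=> i j ij; first by rewrite E ?C0 ?mul0r // ltnW.
by rewrite E ?ij // mulf_neq0 ?C1 // trig_unit_diag.
Qed.

End Triangular.

(** * Krylov matrices and cyclic vectors *)

Definition krylov (F : pzRingType) n (B : 'M[F]_n) (v : 'rV[F]_n) : 'M[F]_n :=
  \matrix_(i < n) (v *m B ^+ i).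

Lemma exp_mxS (F : pzRingType) n (B : 'M[F]_n) k : B ^+ k.+1 = B ^+ k *m B.
Proof. by rewrite exprSr. Qed.

Lemma trmx_exp (F : comPzRingType) n (B : 'M[F]_n) k : (B ^+ k)^T = B^T ^+ k.
Proof.
elim: k => [|k IH]; first by rewrite !expr0 trmx1.
by rewrite exp_mxS trmx_mul IH exprS.
Qed.

Lemma map_krylov (F F' : pzRingType) (f : {rmorphism F -> F'}) n
    (B : 'M[F]_n) v :
  map_mx f (krylov B v) = krylov (map_mx f B) (map_mx f v).
Proof.
apply/row_matrixP=> i; rewrite -map_row !rowK map_mxM; congr (_ *m _).
elim: (i : nat) => [|k IH]; first exact: map_mx1.
by rewrite !exp_mxS map_mxM IH.
Qed.

Lemma krylovD (F : pzRingType) n (B : 'M[F]_n) u v :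
  krylov B (u + v) = krylov B u + krylov B v.
Proof.
by apply/row_matrixP=> i; rewrite rowK [RHS]linearD /= !rowK mulmxDl.
Qed.

Lemma krylovZ (F : pzRingType) n (B : 'M[F]_n) a v :
  krylov B (a *: v) = a *: krylov B v.
Proof.
by apply/row_matrixP=> i; rewrite rowK [RHS]linearZ /= rowK -scalemxAl.
Qed.

(** Row [i] of [K *m B] is row [i + 1] of [K], so every row but the last of the conjugate is a row
    of the identity. *)
Lemma krylov_hessenberg (F : fieldType) n (B : 'M[F]_n) v :
  krylov B v \in unitmx ->
  unreduced_hessenberg (krylov B v *m B *m invmx (krylov B v)).
Proof.
set K := krylov B v => uK.
have E (i j : 'I_n) : (i < j)%N ->
    (K *m B *m invmx K) i j = (j == i.+1 :> nat)%:R.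
  move=> ij; pose i1 := Ordinal (leq_ltn_trans ij (ltn_ord j)).
  have -> : (K *m B *m invmx K) i j = row i (K *m B *m invmx K) 0 j.
    by rewrite [RHS]mxE.
  rewrite -mulmxA row_mul rowK mulmxA -(mulmxA v) -exp_mxS.
  have -> : v *m B ^+ i.+1 = row i1 K by rewrite rowK.
  by rewrite -row_mul mulmxV // !mxE -val_eqE /= eq_sym.
split=> i j ij; first by rewrite E ?(ltnW ij) // gtn_eqF.
by rewrite E ij // eqxx oner_neq0.
Qed.

Lemma row_mul_diag (F : pzRingType) m n (a : 'rV[F]_m) (A : 'M[F]_(m, n)) i :
  row i (diag_mx a *m A) = a 0 i *: row i A.
Proof. by apply/rowP=> j; rewrite mul_diag_mx !mxE. Qed.

(** In the eigenbasis [P], the vector [u *m P *m B ^+ k] has coordinates [u 0 i * a 0 i ^+ k]. *)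
Lemma krylov_eigenbasis (F : comPzRingType) n (B P : 'M[F]_n) (a u : 'rV[F]_n) :
  P *m B = diag_mx a *m P ->
  krylov B (u *m P) = Vandermonde n a *m (diag_mx u *m P).
Proof.
move=> PB; have PBk k : P *m B ^+ k = diag_mx (\row_i a 0 i ^+ k) *m P.
  elim: k => [|k IH].
    rewrite expr0 mulmx1 (_ : diag_mx _ = 1%:M) ?mul1mx //.
    by apply/matrixP=> i j; rewrite !mxE expr0.
  rewrite exp_mxS mulmxA IH -mulmxA PB mulmxA mulmx_diag.
  congr (diag_mx _ *m P).
  by apply/rowP=> i; rewrite !mxE exprSr.
apply/row_matrixP=> k; rewrite rowK -mulmxA PBk row_mul !mulmxA; congr (_ *m P).
by rewrite !mul_mx_diag; apply/rowP=> i; rewrite !mxE mulrC.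
Qed.

Lemma exists_cyclic_vector (F : fieldType) n (B : 'M[F]_n) (s : n.-tuple F) :
  uniq s -> (forall z, z \in s -> eigenvalue B z) ->
  exists v, krylov B v \in unitmx.
Proof.
move=> us es; have /fin_all_exists2[e eB e0] : forall i : 'I_n,
    exists2 v : 'rV_n, v *m B = tnth s i *: v & v != 0.
  by move=> i; apply/eigenvalueP/es/mem_tnth.
pose P := \matrix_i e i; pose a := \row_i tnth s i.
have PB : P *m B = diag_mx a *m P.
  by apply/row_matrixP=> i; rewrite row_mul rowK eB row_mul_diag mxE rowK.
have uV : Vandermonde n a \in unitmx.
  rewrite unitmxE unitfE det_Vandermonde; apply/prodf_neq0=> i _.
  apply/prodf_neq0=> j ij; rewrite !mxE subr_eq0 eq_sym.
  by apply: contraTneq ij => /(tuple_uniqP _ us) ->; rewrite ltnn.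
have uP : P \in unitmx.
  (* Independence of the eigenvectors: a relation [u *m P = 0] has zero Krylov matrix, and
     cancelling the Vandermonde factor leaves each [u 0 i *: e i = 0]. *)
  rewrite -row_free_unit; apply/inj_row_free=> u uP0.
  have /(congr1 (mulmx (invmx (Vandermonde n a)))) := krylov_eigenbasis u PB.
  rewrite mulKmx // uP0 (_ : krylov B 0 = 0) ?mulmx0 => [dP|];
    last by apply/row_matrixP=> i; rewrite rowK mul0mx row0.
  apply/rowP=> i; have /rowP /= := congr1 (row i) dP.
  move: (e0 i) => /rV0Pn[j eij] /(_ j); rewrite row0 row_mul_diag rowK !mxE.
  by move/esym/eqP; rewrite mulf_eq0 (negPf eij) orbF => /eqP.
(* The sum of the eigenvectors is cyclic: its Krylov matrix is Vandermonde times [P]. *)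
exists (const_mx 1 *m P); rewrite (krylov_eigenbasis _ PB) diag_const_mx mul1mx.
by rewrite unitmx_mul uV.
Qed.

(* The polynomial [det (krylov B (a + t b))] in [t] does not vanish at ['i],
   hence it does not vanish at some real [t]. *)
Lemma exists_real_cyclic_vector (R : realType) n (B : 'M[R]_n) v :
  krylov (map_mx (real_complex R) B) v \in unitmx ->
  exists w, krylov B w \in unitmx.
Proof.
pose a := map_mx (@complex.Re R) v; pose b := map_mx (@complex.Im R) v.
have -> : v = map_mx (real_complex R) a + 'i%C *: map_mx (real_complex R) b.
  by apply/rowP=> j; rewrite !mxE -complexE.
rewrite krylovD krylovZ -!map_krylov unitmxE unitfE.
rewrite -horner_det_pencil -map_det_pencil.
set p := det_pencil _ _ => pi.
have /poly_neq0_nonroot[t] : p != 0.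
  by apply: contra_neq pi => ->; rewrite map_poly0 horner0.
rewrite horner_det_pencil -krylovZ -krylovD => pt.
by exists (a + t *: b); rewrite unitmxE unitfE.
Qed.

(** * Hankel matrices of moments *)

Definition hankel (F : pzRingType) (m : nat -> F) k : 'M[F]_k :=
  \matrix_(i < k, j < k) m (i + j)%N.

(** The antidiagonal consists of ones with zeros above it, whatever the moments beyond [r].
    Reversing the rows and transposing gives a lower unitriangular matrix. *)
Lemma det_hankel_delta_neq0 (F : fieldType) (m : nat -> F) r :
  (forall j, (j <= r)%N -> m j = (j == r)%:R) -> \det (hankel m r.+1) != 0.
Proof.
move=> mE; pose s := perm (@rev_ord_inj r.+1).
suff : \det (row_perm s (hankel m r.+1))^T != 0.
  by rewrite det_tr row_permE det_mulmx mulf_eq0 negb_or => /andP[].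
have E (i j : 'I_r.+1) : (i <= j)%N ->
    (row_perm s (hankel m r.+1))^T i j = (i == j :> nat)%:R.
  move=> ij; rewrite !mxE permE /= subSS.
  have jr : (j <= r)%N by rewrite -ltnS.
  rewrite mE; first by rewrite -(eqn_add2l (r - j) i j) (subnK jr).
  by rewrite (leq_trans (_ : _ <= r - j + j)%N) ?leq_add2l // subnK.
rewrite det_trig; last first.
  by apply/is_trig_mxP=> i j ij; rewrite (E _ _ (ltnW ij)) (ltn_eqF ij).
by apply/prodf_neq0=> i _; rewrite (E _ _ (leqnn i)) eqxx oner_neq0.
Qed.

Definition moment (F : pzRingType) n (B : 'M[F]_n)
    (v : 'rV[F]_n) (w : 'cV[F]_n) j : F :=
  (v *m B ^+ j *m w) 0 0.

(* Replacing [w] by [w + t w'] keeps the minors of order at most [r] nonzero for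
   generic [t]; with [w'] dual to [v B^r], the minor of order [r + 1] of the
   Hankel matrix of [w'] is antitriangular, so it also becomes nonzero. *)
Lemma exists_regular_moments (F : numFieldType) n (B : 'M[F]_n) v :
  krylov B v \in unitmx ->
  exists w, forall k, (k <= n)%N -> \det (hankel (moment B v w) k) != 0.
Proof.
move=> uK; suff : forall r, (r <= n)%N -> exists w, forall k, (k <= r)%N ->
    \det (hankel (moment B v w) k) != 0 by apply.
elim=> [|r IH] rn.
  by exists 0 => k; rewrite leqn0 => /eqP ->; rewrite det_mx00 oner_neq0.
have [w hw] := IH (ltnW rn).
pose w' : 'cV_n := invmx (krylov B v) *m delta_mx (Ordinal rn) 0.
have mE j : (j <= r)%N -> moment B v w' j = (j == r)%:R.
  move=> jr; pose j' := Ordinal (leq_ltn_trans jr rn).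
  have -> : moment B v w' j = (row j' (krylov B v) *m w') 0 0 by rewrite rowK.
  by rewrite -row_mul mulKVmx // !mxE eqxx andbT.
pose p k := det_pencil (hankel (moment B v w) k) (hankel (moment B v w') k).
(* A nonroot of the product serves all orders up to [r + 1] at once. *)
have /poly_neq0_nonroot[t] : \prod_(k < r.+2) p k != 0.
  apply/prodf_neq0=> k _; have := ltn_ord k; rewrite !ltnS leq_eqVlt.
  case/predU1P=> [->|kr]; first exact/det_pencil_neq0r/det_hankel_delta_neq0.
  exact/det_pencil_neq0l/hw.
rewrite horner_prod => /prodf_neq0 pt; exists (w + t *: w') => k kr.
have := pt (Ordinal (kr : (k < r.+2)%N)) isT.
rewrite horner_det_pencil /=; congr (\det _ != 0); apply/matrixP=> i j.
rewrite [RHS]mxE /moment mulmxDr -scalemxAr [RHS]mxE mxE.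
by congr (_ + _); rewrite [LHS]mxE // [RHS]mxE; congr (_ * _); rewrite [LHS]mxE.
Qed.

(** * Assembly of the tridiagonal matrix from the two Krylov bases *)

Theorem mainTheorem2 (R : realType) (n : nat) (hn : (1 <= n)%N) (B : 'M[R]_n)
    (hB : has_distinct_complex_eigenvalues B) :
  exists T : 'M[R]_n,
    [/\ B ~_{in unitmx} T, tridiagonal T & off_diagonals_nonzero T].
Proof.
have [s us es] := hB.
have [_ /exists_real_cyclic_vector[v uK]] := exists_cyclic_vector us es.
have [w hw] := exists_regular_moments uK.
have [L [U [tL tU eLU]]] :=
  LU_of_leading_minors (h := fun i j => moment B v w (i + j)) hw.
(* The columns [B ^+ j *m w] are the rows of a Krylov matrix of [B^T], transposed: here [W^T] is the
   matrix written [W] in the outline. *)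
pose K := krylov B v; pose W := krylov B^T w^T.
have eH : K *m W^T = L *m U.
  rewrite -eLU; apply/matrixP=> i j.
  rewrite [RHS]mxE /moment exprD -[_ * _]/(_ *m _) mulmxA -mulmxA.
  have -> : v *m B ^+ i = row i K by rewrite rowK.
  have -> : B ^+ j *m w = col j W^T.
    by rewrite -tr_row rowK -trmx_exp -trmx_mul trmxK.
  by rewrite !mxE; apply: eq_bigr => k _; rewrite !mxE.
have : L *m U \in unitmx by rewrite -eLU unitmxE unitfE hw.
rewrite unitmx_mul => /andP[uL uU].
have uW : W^T \in unitmx.
  have : K *m W^T \in unitmx by rewrite eH unitmx_mul uL.
  by rewrite unitmx_mul => /andP[].
pose T := invmx L *m (K *m B *m invmx K) *m L.
have hT : unreduced_hessenberg T.
  apply: hessenberg_mulr => //; apply: hessenberg_mull; rewrite ?unitmx_inv //.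
    exact: invmx_trig.
  exact: krylov_hessenberg.
have eK : invmx L *m K = U *m invmx W^T.
  by apply: (can_inj (mulmxK uW)); rewrite mulmxKV // -mulmxA eH mulKmx.
(* This second form makes [T^T] a conjugate, by the lower triangular [U^T], of a Hessenberg matrix
   built from [B^T], which controls [T] below the diagonal. *)
have eT : T = U *m invmx W^T *m B *m W^T *m invmx U.
  rewrite /T !mulmxA eK -!mulmxA; congr (U *m (invmx W^T *m (B *m _))).
  apply: (can_inj (mulKmx uK)); rewrite mulKVmx //.
  by rewrite mulmxA eH mulmxK.
have hT' : unreduced_hessenberg T^T.
  have -> : T^T = invmx U^T *m (W *m B^T *m invmx W) *m U^T.
    by rewrite eT !trmx_mul !trmx_inv trmxK !mulmxA.
  have uUT : U^T \in unitmx by rewrite unitmx_tr.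
  apply: hessenberg_mulr => //; apply: hessenberg_mull; rewrite ?unitmx_inv //.
    exact: invmx_trig.
  by apply: krylov_hessenberg; rewrite -unitmx_tr.
exists T; split.
- have uP : invmx L *m K \in unitmx by rewrite unitmx_mul unitmx_inv uL.
  exists (invmx L *m K) => //; apply/(simmxP uP).
  by rewrite /T -!mulmxA mulKVmx // mulVmx // mulmx1.
- move=> i j /orP[ij|ji]; first by rewrite hT.1.
  by have := hT'.1 _ _ ji; rewrite mxE.
- move=> i j ij; split; first exact: hT.2.
  by have := hT'.2 _ _ ij; rewrite mxE.
Qed.
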